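(* For all $p>1$ and $a>1$: (i) $\displaystyle \phi(s)-\kappa_0\ \sim\ -\frac{\kappa_0}{p-1}\Big(\frac{p-1}{4s}\Big)^{a}$ as $s\to+\infty$; (ii) there is $C>0$ such that $\displaystyle |\phi'(s)|\le\frac{C}{s^a}$ for all sufficiently large $s$.
   Context: $f(v)=\dfrac{|v|^{p-1}v}{\log^a(2+v^2)}$ and $\kappa_0=\Big(\frac{2(p+1)}{(p-1)^2}\Big)^{\frac1{p-1}}$. Let $\varphi_0\in C^2([-t_0,0),\mathbb{R})$, $t_0>0$, be a solution of $\varphi_0''=\varphi_0^p+f(\varphi_0)$ with $\varphi_0(t)\sim\kappa_0(-t)^{-\frac2{p-1}}$ as $t\to0^-$, and set $\phi(s)=e^{-\frac{2s}{p-1}}\varphi_0(-e^{-s})$ for $s\ge-\log t_0$. Equivalently $\phi$ satisfies $$\phi''=-\tfrac{2(p+1)}{(p-1)^2}\phi+\phi^p-\tfrac{p+3}{p-1}\phi'+e^{-\frac{2ps}{p-1}}f\big(e^{\frac{2s}{p-1}}\phi\big),\qquad \phi(s)\to\kappa_0\ \text{ as } s\to+\infty.$$ *)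

(* Defs.v *)
From HB Require Import structures.
From mathcomp Require Import all_boot all_order all_algebra.
From mathcomp Require Import all_classical all_reals all_analysis.

Set Implicit Arguments.
Unset Strict Implicit.
Unset Printing Implicit Defensive.

Import Order.TTheory GRing.Theory Num.Theory.
Import numFieldNormedType.Exports.

Local Open Scope classical_set_scope.
Local Open Scope ring_scope.

Definition asymp_equiv (R : realType) (F : set_system R) (FF : Filter F)
    (g h : R -> R) : Prop :=
  g ~_(FilterType F FF) h.
Arguments asymp_equiv {R} F {FF} g h.

(* Differentiation relative to a set [D]: the increments [h] are restricted to
   those with [h + x \in D], so that the derivative is one-sided at an endpoint
   of an interval that belongs to it and two-sided at interior points. *)
Definition derivable_within (R : realType) (D : set R) (g : R -> R) (x : R) :
    Prop :=
  cvg ((fun h : R => h^-1 * (g (h + x) - g x))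
       @ within (fun h : R => D (h + x)) 0^').

Definition derive_within (R : realType) (D : set R) (g : R -> R) (x : R) : R :=
  lim ((fun h : R => h^-1 * (g (h + x) - g x))
       @ within (fun h : R => D (h + x)) 0^').

Definition C2_on (R : realType) (D : set R) (g : R -> R) : Prop :=
  [/\ forall x, D x -> derivable_within D g x,
      forall x, D x -> derivable_within D (derive_within D g) x
    & {within D, continuous (derive_within D (derive_within D g))}].

Definition f (R : realType) (p a v : R) : R :=
  `|v| `^ (p - 1) * v / ln (2 + v ^+ 2) `^ a.

Definition kappa0 (R : realType) (p : R) : R :=
  (2 * (p + 1) / (p - 1) ^+ 2) `^ (1 / (p - 1)).

(* C^2 solution of [v'' = v^p + f v] on [-t0, 0). For an arbitrary real
   exponent, [v^p] has a meaning only if [0 <= v] ([powR] takes the value 1 at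
   negative arguments), so the equation is not required at times where
   [phi0 < 0]; any convention for the power of a negative number gives
   solutions in this sense. *)
Definition is_solution (R : realType) (p a t0 : R) (phi0 : R -> R) : Prop :=
  let D : set R := `[- t0, 0[%classic in
  C2_on D phi0 /\
  forall t, D t -> 0 <= phi0 t ->
    derive_within D (derive_within D phi0) t = phi0 t `^ p + f p a (phi0 t).

(* Meaningful for [- ln t0 <= s], where [- expR (- s)] lies in [-t0, 0). *)
Definition phi (R : realType) (p : R) (phi0 : R -> R) (s : R) : R :=
  expR (- (2 * s / (p - 1))) * phi0 (- expR (- s)).

(* Main.v *)
Require Import Defs.
From mathcomp Require Import all_boot all_order all_algebra.
From mathcomp Require Import all_classical all_reals all_analysis.
From mathcomp Require Import ring lra.
Import Order.TTheory GRing.Theory Num.Theory.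
Import numFieldNormedType.Exports.
Local Open Scope classical_set_scope.
Local Open Scope ring_scope.

(* With beta = 2 / (p - 1), u = phi - kappa0 solves
     u'' + (2 beta + 1) u' = m(s) u + g(s),
   where m -> M := (p - 1) beta (beta + 1) > 0 and g(s) ~ G s^-a.  As m > 0
   eventually, the operator u'' + b u' - m u obeys a maximum principle among
   functions vanishing at infinity.  For A > - G / M the barrier
   A s^-a + K exp (- b s) is a strict supersolution near infinity, hence
   u <= A s^-a eventually; the same applied to - u gives u ~ - (G / M) s^-a.
   The bound on u' follows from (u')' + b u' = O(s^-a). *)

(** * Maximum principle on a half-line *)

Lemma is_derive_continuous_itv (R : realType) (i : interval R) (y y1 : R -> R) :
  (forall s, s \in i -> is_derive s 1 y (y1 s)) ->
  {within [set` i], continuous y}.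
Proof.
move=> dy; apply: derivable_within_continuous => s si.
by have [] := dy s si.
Qed.

(** A positive derivative at the zero [c] makes [y1] positive just to the right of [c], and the mean
    value theorem turns this into strict growth of [y]. It serves to exclude a maximum at a critical
    point with positive second derivative. *)
Lemma derive_gt0_increase (R : realType) (y y1 : R -> R) (c d l : R) :
  c < d -> (forall s, c <= s -> is_derive s 1 y (y1 s)) ->
  is_derive c 1 y1 l -> 0 < l -> y1 c = 0 ->
  exists2 s, c < s < d & y c < y s.
Proof.
move=> cd dy [dy1 <-] l0 y1c.
have : (fun h : R => h^-1 * y1 (h + c)) @ 0^'+ --> 'D_1 y1 c.
  apply: cvg_dnbhs_at_right.
  have : h^-1 *: (y1 (h *: (1 : R) + c) - y1 c) @[h --> (0:R)^'] --> 'D_1 y1 c by [].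
  by under eq_fun do rewrite y1c subr0 [_ *: (1 : R)]mulr1.
move=> /(cvgr_gt _)/(_ _ l0) near0.
have [e /= e0 He] := near0.
have y1pos s : c < s < c + e -> 0 < y1 s.
  move=> /andP[cs se]; have := He (s - c); rewrite /= sub0r normrN subrK.
  rewrite gtr0_norm ?subr_gt0// ltrBlDl => /(_ se cs).
  by rewrite pmulr_rgt0// invr_gt0 subr_gt0.
pose s := c + Num.min (d - c) e / 2.
have m0 : 0 < Num.min (d - c) e by rewrite lt_min subr_gt0 cd.
have md : Num.min (d - c) e <= d - c by rewrite ge_min lexx.
have me : Num.min (d - c) e <= e by rewrite ge_min lexx orbT.
have cs : c < s by rewrite /s; lra.
exists s; first by rewrite cs /= /s; lra.
have dy' x : x \in `[c, s] -> is_derive x 1 y (y1 x).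
  by rewrite in_itv /= => /andP[cx _]; exact: dy.
have dyo x : x \in `]c, s[ -> is_derive x 1 y (y1 x).
  by move/subset_itv_oo_cc; exact: dy'.
have [x] := MVT cs dyo (is_derive_continuous_itv _ _ _ _ dy').
rewrite in_itv /= => /andP[cx xs] E.
have : 0 < y1 x by apply: y1pos; rewrite cx /=; move: xs; rewrite /s; lra.
by move=> y1x; rewrite -subr_gt0 E mulr_gt0// subr_gt0.
Qed.

(** If [y] were positive somewhere, its decay at infinity and [y S <= 0] would force a positive
    maximum inside some [[S, T]]. There [y1 = 0], hence [y2 > 0], and [y] would grow beyond its
    maximum. *)
Lemma max_principle (R : realType) (y y1 y2 : R -> R) (S : R) :
  (forall s, S <= s -> is_derive s 1 y (y1 s)) ->
  (forall s, S <= s -> is_derive s 1 y1 (y2 s)) ->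
  (forall s, S <= s -> 0 < y s -> y1 s = 0 -> 0 < y2 s) ->
  y S <= 0 -> y s @[s --> +oo] --> 0 ->
  forall s, S <= s -> y s <= 0.
Proof.
move=> dy dy1 y2pos yS y0 s1 Ss1; rewrite leNgt; apply/negP => ys1.
(* The strict inequality [y T < y s1] keeps the maximum over [[S, T]] away from the right
   endpoint. *)
have [T [s1T yT]] : exists T, s1 < T /\ y T < y s1.
  near (pinfty_nbhs R) => T; exists T; split; near: T.
    by apply: nbhs_pinfty_gt; exact: num_real.
  exact: (cvgr_lt _ y0).
have ST : S <= T by rewrite (le_trans Ss1)// ltW.
have dyST x : x \in `[S, T] -> is_derive x 1 y (y1 x).
  by rewrite in_itv /= => /andP[Sx _]; exact: dy.
have [c] := EVT_max ST (is_derive_continuous_itv _ _ _ _ dyST).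
rewrite in_itv /= => /andP[Sc cT] cmax.
have ys1c : y s1 <= y c by apply: cmax; rewrite in_itv /= Ss1 ltW.
have yc : 0 < y c by exact: lt_le_trans ys1c.
have {}Sc : S < c.
  by rewrite lt_neqAle Sc andbT; apply: contraTneq yc => <-; rewrite -leNgt.
have {}cT : c < T.
  by rewrite lt_neqAle cT andbT; apply: contraTneq yT => <-; rewrite -leNgt.
have y1c : y1 c = 0.
  have [_ <-] := dy c (ltW Sc).
  suff [_ ->] : is_derive c 1 y 0 by [].
  apply: (derive1_at_max ST) => [t tST||t tST].
  - by have [] := dyST t (subset_itv_oo_cc tST).
  - by rewrite in_itv /= Sc.
  - by apply: cmax; exact: subset_itv_oo_cc.
have dyc s : c <= s -> is_derive s 1 y (y1 s).
  by move=> cs; apply: dy; exact: le_trans (ltW Sc) cs.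
have y2c := y2pos _ (ltW Sc) yc y1c.
have [s /andP[cs sT]] :=
  derive_gt0_increase _ _ _ _ _ _ cT dyc (dy1 c (ltW Sc)) y2c y1c.
apply/negP; rewrite -leNgt; apply: cmax.
by rewrite in_itv /= (ltW sT) andbT ltW// (lt_trans Sc).
Unshelve. all: by end_near. Qed.

(** * Powers and exponentials at infinity *)

Lemma powR_mul_expRN_cvg0 (R : realType) (a b : R) : 0 < a -> 0 < b ->
  s `^ a * expR (- (b * s)) @[s --> +oo] --> 0.
Proof.
(* Half of the exponential absorbs the power: [ln x <= x - 1] at [x = b s / (2 a)] gives
   [a ln s <= k + b s / 2]. *)
move=> a0 b0; pose k := a * ln (2 * a / b).
have k0 : 0 < 2 * a / b by rewrite !mulr_gt0// invr_gt0.
have -> : (0 : R) = expR k * 0 by rewrite mulr0.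
apply: (@squeeze_cvgr _ _ _ _ (cst 0) (fun s => expR k * expR (- (b / 2 * s)))).
- near=> s.
  have s0 : 0 < s by near: s; apply: nbhs_pinfty_gt; exact: num_real.
  rewrite mulr_ge0 ?powR_ge0 ?expR_ge0//= /powR gt_eqF// -!expRD ler_expR.
  pose x := b / (2 * a) * s.
  have x0 : 0 < x by rewrite /x !mulr_gt0// invr_gt0 mulr_gt0.
  have sE : s = (2 * a / b) * x by rewrite /x; field; rewrite !gt_eqF.
  rewrite {1}sE lnM ?posrE//.
  have lnx : ln x <= x - 1.
    by have := @le_ln1Dx R (x - 1); rewrite subrKC; apply; lra.
  rewrite mulrDr -/k.
  have : a * ln x <= a * x by rewrite ler_pM2l//; lra.
  have -> : a * x = b / 2 * s by rewrite /x; field; rewrite gt_eqF.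
  lra.
- by rewrite mulr0; exact: cvg_cst.
- apply: cvgMl_tmp.
  apply: (@cvg_comp _ _ _ (fun s : R => b / 2 * s) (fun x => expR (- x)) _ +oo).
    apply: gt0_cvgMry; [by rewrite divr_gt0|exact: cvg_id].
  exact: cvgr_expR.
Unshelve. all: by end_near. Qed.

Lemma expRN_cvg0 (R : realType) (b : R) : 0 < b ->
  expR (- b * s) @[s --> +oo] --> 0.
Proof.
move=> b0; under eq_fun do rewrite mulNr.
apply: (@cvg_comp _ _ _ (fun s : R => b * s) (fun x => expR (- x)) _ +oo).
  by apply: gt0_cvgMry => //; exact: cvg_id.
exact: cvgr_expR.
Qed.

Lemma powRN_cvg0 (R : realType) (a : R) : 0 < a ->
  s `^ (- a) @[s --> +oo] --> 0.
Proof.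
move=> a0.
under eq_fun do rewrite powRN.
apply/gtr0_cvgV0.
  near=> s.
  by apply: powR_gt0; near: s; apply: nbhs_pinfty_gt; exact: num_real.
apply/cvgryPge => A.
near=> s.
have As : `|A| `^ a^-1 <= s by near: s; apply: nbhs_pinfty_ge; exact: num_real.
apply: (le_trans (ler_norm A)).
rewrite -[leLHS]powRr1// -(mulVf (lt0r_neq0 a0)) powRrM.
by apply: ge0_ler_powR => //; rewrite ?nnegrE ?powR_ge0 ?ltW//.
Unshelve. all: by end_near. Qed.

Lemma is_derive_powRN (R : realType) (a s : R) : 0 < s ->
  is_derive s 1 (fun x => x `^ (- a)) (- (a / s * s `^ (- a))).
Proof.
move=> s0; apply: is_derive_eq; first exact: is_derive1_powR.
rewrite powRD; last by rewrite (gt_eqF s0) implybT.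
by rewrite powR_inv1 ?ltW//; ring.
Qed.

Lemma is_derive_expRM (R : realType) (b s : R) :
  is_derive s 1 (fun x => expR (b * x)) (b * expR (b * s)).
Proof.
have dl : is_derive s 1 (fun x => b * x) b.
  by apply: is_derive_eq; rewrite [LHS]mulr1.
by rewrite mulrC; exact: (is_derive1_comp (is_derive_expR (b * s)) dl).
Qed.

(** * Barrier comparison for the second-order equation *)

Lemma near_pinfty_ge (R : realType) (P : R -> Prop) :
  (\forall s \near +oo, P s) -> exists2 S, 0 < S & forall s, S <= s -> P s.
Proof.
move=> [M [_ HM]]; exists (`|M| + 1) => [|s Ms]; first by rewrite ltr_wpDl.
by apply: HM; apply: lt_le_trans Ms; rewrite (le_lt_trans (ler_norm M))// ltrDl.
Qed.

Lemma ode_eventually_le (R : realType) (u u1 u2 m g : R -> R) (a b M G A : R) :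
  0 < a -> 0 < b -> 0 < M -> - G < M * A ->
  (\forall s \near +oo, is_derive (s : R) 1 u (u1 s)) ->
  (\forall s \near +oo, is_derive (s : R) 1 u1 (u2 s)) ->
  (\forall s \near +oo, u2 s + b * u1 s = m s * u s + g s) ->
  m s @[s --> +oo] --> M -> g s * s `^ a @[s --> +oo] --> G ->
  u s @[s --> +oo] --> 0 ->
  \forall s \near +oo, u s <= A * s `^ (- a).
Proof.
move=> a0 b0 M0 GA du du1 ode mM gG u0.
pose B := (A - G / M) / 2.
have AB : B < A.
  have : - G / M < A by rewrite ltr_pdivrMr// mulrC.
  by rewrite mulNr /B; lra.
have GB : - (M * B) - G < 0.
  have -> : - (M * B) - G = (- G - M * A) / 2 by rewrite /B; field; rewrite gt_eqF.
  by lra.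
(* For [h = B s^-a], the residual [h'' + b h' - m h - g] equals [s^-a * k s], and [k] tends to
   [- M B - G < 0]. *)
pose k s := B * ((a + a ^+ 2) * s^-1 ^+ 2 - b * a * s^-1) - m s * B - g s * s `^ a.
have ks : \forall s \near +oo, k s < 0.
  apply: (cvgr_lt (- (M * B) - G)) => //.
  have iv0 : (s : R)^-1 @[s --> +oo] --> 0.
    apply/gtr0_cvgV0; last exact: cvg_id.
    by apply: nbhs_pinfty_gt; exact: num_real.
  apply: cvgB; last exact: gG.
  rewrite -[- (M * B)]add0r; apply: cvgB; last exact: cvgMr_tmp.
  rewrite -(mulr0 B); apply: cvgMl_tmp.
  rewrite (_ : 0 = (a + a ^+ 2) * 0 ^+ 2 - b * a * 0); last by ring.
  apply: cvgB; apply: cvgMl_tmp => //.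
  exact: (@cvgM _ _ _ _ (fun s : R => s^-1) (fun s : R => s^-1)).
have mpos : \forall s \near +oo, 0 < m s by apply: (cvgr_gt M).
have [S S0 HS] : exists2 S, 0 < S & forall s, S <= s ->
    [/\ is_derive (s : R) 1 u (u1 s), is_derive s 1 u1 (u2 s),
        u2 s + b * u1 s = m s * u s + g s, 0 < m s & k s < 0].
  apply: near_pinfty_ge; near=> s.
  by split; near: s.
(* [exp (- b s)] satisfies v'' + b v' = 0, so it only contributes - m v < 0. *)
pose K := `|u S - B * S `^ (- a)| * expR (b * S).
pose y s := u s - B * s `^ (- a) - K * expR (- b * s).
pose y1 s := u1 s + B * (a / s * s `^ (- a)) + K * b * expR (- b * s).
pose y2 s := u2 s - B * ((a + a ^+ 2) * s^-1 ^+ 2 * s `^ (- a))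
               - K * b ^+ 2 * expR (- b * s).
have Sgt0 s : S <= s -> 0 < s by exact: lt_le_trans.
have ule s : S <= s -> y s <= 0.
  apply: (@max_principle R y y1 y2).
  - move=> {}s Ss; have [dus _ _ _ _] := HS s Ss.
    have dh := is_derive_powRN _ a s (Sgt0 s Ss).
    have de := is_derive_expRM _ (- b) s.
    apply: is_derive_eq; rewrite /y1 /GRing.scale /=; ring.
  - move=> {}s Ss; have [_ dus _ _ _] := HS s Ss.
    have dh := is_derive_powRN _ a s (Sgt0 s Ss).
    have de := is_derive_expRM _ (- b) s.
    have s0 : s != 0 by rewrite gt_eqF// Sgt0.
    have di : is_derive s 1 (fun x : R => x^-1) (- s ^- 2).
      by apply: is_derive_eq; [exact: is_deriveV|rewrite [_ *: _]mulr1].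
    apply: is_derive_eq; rewrite /y2 /GRing.scale /=; field.
    exact: s0.
  - move=> {}s Ss ys y1s; have [_ _ E ms kS] := HS s Ss.
    have s0 := Sgt0 s Ss.
    have hh : s `^ (- a) * s `^ a = 1.
      by rewrite powRN mulVf// gt_eqF// powR_gt0.
    have gE : g s = s `^ (- a) * (g s * s `^ a) by rewrite mulrCA hh mulr1.
    have u2E : u2 s = m s * u s + g s - b * u1 s by rewrite -E addrK.
    have u1E : u1 s = - (B * (a / s * s `^ (- a)) + K * b * expR (- b * s)).
      by move: y1s; rewrite /y1; lra.
    (* With [y1 s = 0] and the equation, all first-order and pure exponential terms cancel. What
       remains is positive, since [m > 0], [y > 0], [K >= 0] and [k < 0]. *)
    have -> : y2 s = m s * (y s + K * expR (- b * s)) - s `^ (- a) * k s.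
      by rewrite /y2 u2E u1E {1}gE /y /k; ring.
    rewrite subr_gt0 (@lt_trans _ _ 0)//.
      by rewrite pmulr_rlt0// powR_gt0.
    by rewrite mulr_gt0// ltr_wpDr// mulr_ge0 ?expR_ge0// mulr_ge0 ?expR_ge0.
  (* [K] was chosen so that the exponential term at [S] equals [|u S - B S^-a|]. *)
  - rewrite /y /K -mulrA -expRD mulNr subrr expR0 mulr1.
    by rewrite subr_le0 ler_norm.
  - have -> : (0 : R) = 0 - B * 0 - K * 0 by ring.
    apply: cvgB; first apply: cvgB => //.
      by apply: cvgMl_tmp; exact: powRN_cvg0.
    by apply: cvgMl_tmp; exact: expRN_cvg0.
(* Relative to [s^-a] the exponential term vanishes, so it is eventually at most [(A - B) s^-a]. *)
have e0 : K * (s `^ a * expR (- (b * s))) @[s --> +oo] --> 0.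
  by rewrite -(mulr0 K); apply: cvgMl_tmp; exact: powR_mul_expRN_cvg0.
near=> s.
have Ss : S <= s by near: s; apply: nbhs_pinfty_ge; exact: num_real.
have h0 : 0 < s `^ a by rewrite powR_gt0// Sgt0.
have := ule s Ss; rewrite /y.
have : K * (s `^ a * expR (- (b * s))) <= A - B.
  by near: s; apply: (cvgr_le _ e0); rewrite subr_gt0.
rewrite powRN mulNr.
rewrite -(ler_pM2r (_ : 0 < (s `^ a)^-1)) ?invr_gt0//.
have -> : K * (s `^ a * expR (- (b * s))) / s `^ a = K * expR (- (b * s)).
  by field; rewrite gt_eqF.
by lra.
Unshelve. all: by end_near. Qed.

(** The one-sided bound is used twice: for [u] with coefficient [e - G / M], and for [- u], whose
    forcing [- g] has limit [- G], with coefficient [e + G / M]. *)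
Lemma ode_eventually_asymp (R : realType) (u u1 u2 m g : R -> R) (a b M G : R) :
  0 < a -> 0 < b -> 0 < M ->
  (\forall s \near +oo, is_derive (s : R) 1 u (u1 s)) ->
  (\forall s \near +oo, is_derive (s : R) 1 u1 (u2 s)) ->
  (\forall s \near +oo, u2 s + b * u1 s = m s * u s + g s) ->
  m s @[s --> +oo] --> M -> g s * s `^ a @[s --> +oo] --> G ->
  u s @[s --> +oo] --> 0 ->
  forall e, 0 < e ->
    \forall s \near +oo, `|u s + G / M * s `^ (- a)| <= e * s `^ (- a).
Proof.
move=> a0 b0 M0 du du1 ode mM gG u0 e e0.
have leM : M * (G / M) = G by field; rewrite gt_eqF.
have Me : 0 < M * e by rewrite mulr_gt0.
have up : \forall s \near +oo, u s <= (e - G / M) * s `^ (- a).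
  by apply: (ode_eventually_le _ u u1 u2 m g a b M G) => //; rewrite mulrBr leM; lra.
have lo : \forall s \near +oo, - u s <= (e + G / M) * s `^ (- a).
  apply: (ode_eventually_le _ (fun s => - u s) (fun s => - u1 s)
    (fun s => - u2 s) m (fun s => - g s) a b M (- G)) => //.
  - by rewrite mulrDr leM; lra.
  - by apply: filterS du => s du; exact: is_deriveN.
  - by apply: filterS du1 => s du1; exact: is_deriveN.
  - by apply: filterS ode => s E; lra.
  - by under eq_fun do rewrite mulNr; exact: cvgN.
  - by rewrite -oppr0; exact: cvgN.
near=> s.
have us : u s <= (e - G / M) * s `^ (- a) by near: s.
have ls : - u s <= (e + G / M) * s `^ (- a) by near: s.
by rewrite ler_norml; apply/andP; split; lra.
Unshelve. all: by end_near. Qed.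

(** * First-order linear inequalities with power-like forcing *)

Lemma linear_ode_eventually_le (R : realType) (w w1 : R -> R) (a b K : R) :
  0 < a -> 0 < b ->
  (\forall s \near +oo, is_derive (s : R) 1 w (w1 s)) ->
  (\forall s \near +oo, w1 s + b * w s <= K * s `^ (- a)) ->
  exists2 C, 0 < C & \forall s \near +oo, w s <= C * s `^ (- a).
Proof.
move=> a0 b0 dw wK.
(* The bound [2 a / b <= s] ensures [a / s <= b / 2], so that [b - a / s >= b / 2] beyond [S]. *)
have [S S0 HS] : exists2 S, 0 < S & forall s, S <= s ->
    [/\ is_derive (s : R) 1 w (w1 s), w1 s + b * w s <= K * s `^ (- a) &
        2 * a / b <= s].
  apply: near_pinfty_ge; near=> s; split; near: s => //.
  by apply: nbhs_pinfty_ge; exact: num_real.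
have Sgt0 s : S <= s -> 0 < s by exact: lt_le_trans.
(* The first summand dominates [K] through [b - a / s >= b / 2], the second gives [w S <= C S^-a],
   and the 1 makes [C] positive. *)
pose C := 2 * `|K| / b + `|w S| * S `^ a + 1.
have C0 : 0 < C.
  by rewrite ltr_wpDl// addr_ge0 ?mulr_ge0 ?powR_ge0 ?invr_ge0// ltW.
exists C => //.
(* With the integrating factor [exp (b s)], the excess of [w] over [C s^-a] becomes nonincreasing;
   it starts nonpositive at [S]. *)
pose y s := expR (b * s) * (w s - C * s `^ (- a)).
pose y1 s := expR (b * s) * (w1 s + b * w s - C * s `^ (- a) * (b - a / s)).
have dy s : S <= s -> is_derive s 1 y (y1 s).
  move=> Ss; have [dws _ _] := HS s Ss.
  have dh := is_derive_powRN _ a s (Sgt0 s Ss).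
  have de := is_derive_expRM _ b s.
  have s0 : s != 0 by rewrite gt_eqF// Sgt0.
  apply: is_derive_eq; rewrite /y1 /GRing.scale /=; field.
  exact: s0.
have y1le s : S <= s -> y1 s <= 0.
  move=> Ss; have [_ E bs] := HS s Ss.
  rewrite /y1 pmulr_rle0 ?expR_gt0// subr_le0 (le_trans E)//.
  have -> : C * s `^ (- a) * (b - a / s) = (C * (b - a / s)) * s `^ (- a).
    by ring.
  rewrite ler_wpM2r ?powR_ge0//.
  have as2 : a / s <= b / 2.
    rewrite ler_pdivrMr ?Sgt0//.
    move: bs; rewrite ler_pdivrMr//; lra.
  rewrite (le_trans (ler_norm K))//.
  have -> : `|K| = (2 * `|K| / b) * (b / 2) by field; rewrite gt_eqF.
  rewrite ler_pM//; last by lra.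
  + by rewrite !mulr_ge0 ?invr_ge0// ltW.
  + by rewrite divr_ge0// ltW.
  + by rewrite /C -addrA lerDl addr_ge0// mulr_ge0 ?powR_ge0.
have yS : y S <= 0.
  rewrite /y pmulr_rle0 ?expR_gt0// subr_le0 powRN ler_pdivlMr ?powR_gt0//.
  rewrite /C -addrA ler_wpDl//; first by rewrite !mulr_ge0 ?invr_ge0// ltW.
  by rewrite ler_wpDr// ler_wpM2r ?powR_ge0 ?ler_norm.
have yle s : S <= s -> y s <= 0.
  move=> Ss; apply: le_trans yS.
  apply: (@ler0_derive1_nincry R y S) => //.
  - move=> x; rewrite in_itv /= andbT => /ltW Sx.
    by have [] := dy x Sx.
  - move=> x; rewrite in_itv /= andbT => /ltW Sx.
    by rewrite derive1E; have [_ ->] := dy x Sx; exact: y1le.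
  - apply: (@is_derive_continuous_itv _ _ y y1) => x.
    by rewrite in_itv /= andbT; exact: dy.
near=> s.
have : S <= s by near: s; apply: nbhs_pinfty_ge; exact: num_real.
by move/yle; rewrite /y pmulr_rle0 ?expR_gt0// subr_le0.
Unshelve. all: by end_near. Qed.

Lemma linear_ode_eventually_bounded (R : realType) (w w1 : R -> R) (a b K : R) :
  0 < a -> 0 < b ->
  (\forall s \near +oo, is_derive (s : R) 1 w (w1 s)) ->
  (\forall s \near +oo, `|w1 s + b * w s| <= K * s `^ (- a)) ->
  exists2 C, 0 < C & \forall s \near +oo, `|w s| <= C * s `^ (- a).
Proof.
move=> a0 b0 dw wK.
have [C1 C10 H1] : exists2 C, 0 < C & \forall s \near +oo, w s <= C * s `^ (- a).
  apply: (linear_ode_eventually_le _ w w1 a b K) => //.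
  by apply: filterS wK => s; apply: le_trans; exact: ler_norm.
have [C2 C20 H2] : exists2 C, 0 < C & \forall s \near +oo, - w s <= C * s `^ (- a).
  apply: (linear_ode_eventually_le _ (fun s => - w s) (fun s => - w1 s) a b K) => //.
    by apply: filterS dw => s dw; exact: is_deriveN.
  apply: filterS wK => s; apply: le_trans.
  by rewrite mulrN -opprD -normrN ler_norm.
exists (C1 + C2); first exact: addr_gt0.
near=> s.
have us : w s <= C1 * s `^ (- a) by near: s.
have ls : - w s <= C2 * s `^ (- a) by near: s.
have h1 : 0 <= C1 * s `^ (- a) by rewrite mulr_ge0 ?powR_ge0 ?ltW.
have h2 : 0 <= C2 * s `^ (- a) by rewrite mulr_ge0 ?powR_ge0 ?ltW.
by rewrite ler_norml mulrDl; apply/andP; split; lra.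
Unshelve. all: by end_near. Qed.

(** * From [phi0] to [phi]: the equation in the variable [s] and its logarithmic forcing *)

Lemma is_derive_derive_within (R : realType) (D : set R) (g : R -> R) (x : R) :
  nbhs x D -> derivable_within D g x -> is_derive x 1 g (derive_within D g x).
Proof.
move=> xD cg.
(* At an interior point all small increments stay in [D], so the restricted filter is the full
   punctured neighbourhood filter. *)
have DE : within (fun h : R => D (h + x)) 0^' = (0 : R)^'.
  have near0 : \forall h \near (0 : R)^', D (h + x).
    have [e /= e0 He] := xD.
    by exists e => //= h /= he _; apply: He; rewrite /= opprD addrCA subrr addr0 -sub0r.
  apply/seteqP; split => A.
    move=> WA; apply: (@filterS2 _ (0 : R)^' _ _ _ _ _ near0 WA) => h Dh; exact.
  move=> WA; apply: (@filterS _ (0 : R)^' _ _ _ _ WA) => h Ah _; exact: Ah.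
pose q (h : R) : R := h^-1 *: (g (h *: (1 : R) + x) - g x).
have qE : q = fun h : R => h^-1 * (g (h + x) - g x).
  by apply/funext => h; rewrite /q [h *: (1 : R)]mulr1.
have dg : derivable g x 1.
  by move: cg; rewrite /derivable_within DE -qE.
apply: DeriveDef => //.
by rewrite /derive_within DE -qE.
Qed.

Lemma near_left_expRN (R : realType) (P : R -> Prop) :
  (\forall t \near (0 : R)^'-, P t) -> \forall s \near +oo, P (- expR (- s)).
Proof.
move=> [e /= e0 He].
have : \forall s \near +oo, expR (- s) < e.
  by apply: (cvgr_lt (0 : R)) => //; exact: cvgr_expR.
apply: filterS => s se; apply: He; last by rewrite oppr_lt0 expR_gt0.
by rewrite /= sub0r opprK gtr0_norm ?expR_gt0.
Qed.

(** Factoring [exp (2 b s)] out of the argument turns the logarithm into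
    [2 b s + ln (2 exp (- 2 b s) + w^2)], whose second term converges to [ln (k^2)]. *)
Lemma ln_expR_sqr_cvg (R : realType) (b k : R) (w : R -> R) : 0 < k -> 0 < b ->
  w s @[s --> +oo] --> k ->
  ln (2 + (expR (b * s) * w s) ^+ 2) / s @[s --> +oo] --> 2 * b.
Proof.
move=> k0 b0 wk.
have -> : 2 * b = 2 * b + ln (2 * 0 + k * k) * 0 by ring.
apply: (@cvg_trans _
  ((2 * b + ln (2 * expR (- (2 * b) * s) + w s * w s) * s^-1) @[s --> +oo])).
  apply: near_eq_cvg; near=> s.
  have s0 : 0 < s by near: s; apply: nbhs_pinfty_gt; exact: num_real.
  have E0 : 0 < 2 * expR (- (2 * b) * s) + w s * w s.
    by rewrite ltr_pwDl ?mulr_gt0 ?expR_gt0// -expr2 sqr_ge0.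
  have -> : 2 + (expR (b * s) * w s) ^+ 2 =
      expR (2 * b * s) * (2 * expR (- (2 * b) * s) + w s * w s).
    rewrite mulrDr mulrCA mulNr expRN divff ?gt_eqF ?expR_gt0//.
    have -> : expR (2 * b * s) = expR (b * s) * expR (b * s).
      by rewrite -expRD; congr expR; ring.
    by ring.
  rewrite lnM ?posrE ?expR_gt0// expRK; field.
  by rewrite gt_eqF.
apply: cvgD; first exact: cvg_cst.
apply: cvgM.
  apply: continuous_cvg; first by apply: continuous_ln; rewrite mulr0 add0r mulr_gt0.
  apply: cvgD; last exact: cvgM.
  by apply: cvgMl_tmp; apply: expRN_cvg0; rewrite mulr_gt0.
apply/gtr0_cvgV0; last exact: cvg_id.
by apply: nbhs_pinfty_gt; exact: num_real.
Unshelve. all: by end_near. Qed.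

Lemma cvg_powR (R : realType) (T : Type) (F : set_system T)
    (h : T -> R) (a l : R) : 0 < l ->
  h x @[x --> F] --> l -> h x `^ a @[x --> F] --> l `^ a.
Proof.
move=> l0 hl.
have [/derivable1_diffP/differentiable_continuous c _] := is_derive1_powR a l0.
exact: cvg_comp _ _ hl c.
Qed.

Lemma asymp_equivP (R : realType) (F : set_system R) (FF : Filter F)
    (g h : R -> R) :
  asymp_equiv F g h <->
  (forall e, 0 < e -> \forall x \near F, `|g x - h x| <= e * `|h x|).
Proof. exact: eqaddoP. Qed.

Lemma phi_cvg (R : realType) (p : R) (phi0 : R -> R) : 1 < p ->
  asymp_equiv (0 : R)^'- phi0
    (fun t : R => kappa0 p * (- t) `^ (- (2 / (p - 1)))) ->
  phi p phi0 s @[s --> +oo] --> kappa0 p.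
Proof.
move=> p1 /asymp_equivP as0.
have k0 : 0 <= kappa0 p by exact: powR_ge0.
apply/cvgrPdist_le => e e0.
(* The factor [exp (- 2 s / (p - 1))] cancels the power of [- t] exactly at [t = - exp (- s)],
   leaving a relative error times [kappa0 p]; the added 1 keeps the denominator positive. *)
have e1 : 0 < e / (kappa0 p + 1) by rewrite divr_gt0// ltr_wpDl.
have := near_left_expRN _ _ (as0 _ e1); apply: filterS => s.
rewrite opprK -expRM => hs.
have hE : expR (- (2 * s / (p - 1))) * expR (- s * - (2 / (p - 1))) = 1.
  by rewrite -expRD -[RHS]expR0; congr expR; ring.
have kE : kappa0 p = expR (- (2 * s / (p - 1))) *
    (kappa0 p * expR (- s * - (2 / (p - 1)))) by rewrite mulrCA hE mulr1.
rewrite distrC /phi {1}kE -mulrBr normrM.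
rewrite gtr0_norm ?expR_gt0//.
apply: (@le_trans _ _ (expR (- (2 * s / (p - 1))) * (e / (kappa0 p + 1) *
    `|kappa0 p * expR (- s * - (2 / (p - 1)))|))).
  by rewrite ler_pM2l ?expR_gt0.
rewrite normrM (ger0_norm k0) (gtr0_norm (expR_gt0 _)) mulrCA -kE.
rewrite mulrAC ler_pdivrMr ?ltr_wpDl//.
by rewrite ler_pM2l// lerDl.
Qed.

(** Chain rule for [phi s = exp (- beta s) phi0 (- exp (- s))]. Nonnegativity of [phi] is assumed
    near infinity because the equation for [phi0] is imposed only where [phi0 >= 0]. *)
Lemma phi_ode (R : realType) (p a t0 : R) (phi0 : R -> R) (beta := 2 / (p - 1)) :
  1 < p -> 0 < t0 -> is_solution p a t0 phi0 ->
  (\forall s \near +oo, 0 <= phi p phi0 s) ->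
  exists u1 u2 : R -> R,
    [/\ \forall s \near +oo, is_derive (s : R) 1 (phi p phi0) (u1 s),
        \forall s \near +oo, is_derive (s : R) 1 u1 (u2 s) &
        \forall s \near +oo, u2 s + (2 * beta + 1) * u1 s =
          - (beta * (beta + 1)) * phi p phi0 s + phi p phi0 s `^ p +
          expR (- (p * beta) * s) * f p a (expR (beta * s) * phi p phi0 s)].
Proof.
move=> p1 t00; rewrite /is_solution; set D := [set` `[- t0, 0[].
move=> [[d1 d2 _] eqn] phi_ge0.
have p10 : p - 1 != 0 by rewrite subr_eq0 gt_eqF.
pose T (s : R) := - expR (- 1 * s).
pose psi := derive_within D phi0.
pose chi := derive_within D psi.
have phiE : phi p phi0 = fun s => expR (- beta * s) * phi0 (T s).
  apply/funext => s; rewrite /phi /T mulN1r; congr (expR _ * _).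
  by rewrite /beta; ring.
(* For large [s] the time [T s] is interior to [D], so the relative derivatives there are ordinary
   ones. *)
have nD : \forall s \near +oo, nbhs (T s) D.
  have : \forall t \near (0 : R)^'-, nbhs t D.
    near=> t.
    have tl : - t0 < t by near: t; apply: nbhs_left_gt; rewrite oppr_lt0.
    have tu : t < 0 by near: t; exact: nbhs_left_lt.
    have : t \in `]- t0, 0[ by rewrite in_itv /= tl tu.
    move/near_in_itvoo; apply: filterS => x.
    by move=> xoo; apply: subset_itv_oo_co; exact: xoo.
  by move/near_left_expRN; apply: filterS => s; rewrite /T mulN1r.
pose u1 s := - beta * phi p phi0 s + expR (- (beta + 1) * s) * psi (T s).
pose u2 s := - beta * u1 s - (beta + 1) * expR (- (beta + 1) * s) * psi (T s)
  + expR (- (beta + 2) * s) * chi (T s).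
have dT (s : R) : is_derive s 1 T (expR (- 1 * s)).
  have de := is_derive_expRM _ (- 1) s.
  by apply: is_derive_eq; ring.
have dcomp (h h1 : R -> R) (s : R) : is_derive (T s) 1 h (h1 (T s)) ->
    is_derive s 1 (fun x => h (T x)) (h1 (T s) * expR (- 1 * s)).
  by move=> dh; exact: (is_derive1_comp dh (dT s)).
have dphi (s : R) : nbhs (T s) D -> is_derive s 1 (phi p phi0) (u1 s).
  move=> Ds.
  have dh := dcomp _ _ _
    (is_derive_derive_within _ _ _ _ Ds (d1 _ (nbhs_singleton Ds))).
  have de := is_derive_expRM _ (- beta) s.
  have E : expR (- (beta + 1) * s) = expR (- beta * s) * expR (- 1 * s).
    by rewrite -expRD; congr expR; ring.
  rewrite /u1 phiE E; apply: is_derive_eq.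
  by rewrite /GRing.scale /= /psi; ring.
exists u1, u2; split.
- exact: filterS nD.
- apply: filterS nD => s Ds.
  have dh := dcomp _ _ _
    (is_derive_derive_within _ _ _ _ Ds (d2 _ (nbhs_singleton Ds))).
  have dp := dphi s Ds.
  have de := is_derive_expRM _ (- (beta + 1)) s.
  have E : expR (- (beta + 2) * s) = expR (- (beta + 1) * s) * expR (- 1 * s).
    by rewrite -expRD; congr expR; ring.
  rewrite /u2 E; apply: is_derive_eq.
  by rewrite /GRing.scale /= /chi /psi; ring.
- near=> s.
  have Ds : nbhs (T s) D by near: s.
  have phis : 0 <= phi p phi0 s by near: s.
  have phi0E : phi0 (T s) = expR (beta * s) * phi p phi0 s.
    by rewrite phiE mulNr expRN mulrA divff ?mul1r// gt_eqF// expR_gt0.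
  have -> : u2 s + (2 * beta + 1) * u1 s = - (beta * (beta + 1)) * phi p phi0 s
      + expR (- (beta + 2) * s) * chi (T s).
    by rewrite /u2 /u1; ring.
  rewrite -addrA; congr (_ + _).
  (* This scaling identity makes [exp (- (beta + 2) s) phi0^p] equal to [phi^p], with no explicit
     dependence on [s]. *)
  have b2 : beta + 2 = p * beta by rewrite /beta; field.
  rewrite /chi /psi eqn; first last.
  + by rewrite phi0E mulr_ge0// expR_ge0.
  + exact: nbhs_singleton Ds.
  rewrite phi0E b2 mulrDr; congr (_ + _).
  rewrite powRM ?expR_ge0// -expRM mulrA -expRD -[RHS]mul1r -expR0.
  by congr (expR _ * _); ring.
Unshelve. all: by end_near. Qed.

(** Where [w > 0], the power in [f] produces [exp (p b s) w^p], which cancels the prefactor. There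
    remains [w^p (s / L)^a], with [L] the logarithm, and [L / s] tends to [2 b]. *)
Lemma nonlinearity_cvg (R : realType) (p a b k : R) (w : R -> R) :
  0 < p -> 0 < b -> 0 < k -> w s @[s --> +oo] --> k ->
  expR (- (p * b) * s) * f p a (expR (b * s) * w s) * s `^ a @[s --> +oo] -->
    k `^ p * (2 * b)^-1 `^ a.
Proof.
move=> p0 b0 k0 wk.
pose L s := ln (2 + (expR (b * s) * w s) ^+ 2).
apply: (@cvg_trans _ ((w s `^ p * (L s / s)^-1 `^ a) @[s --> +oo])).
  apply: near_eq_cvg; near=> s.
  have s0 : 0 < s by near: s; apply: nbhs_pinfty_gt; exact: num_real.
  have ws : 0 < w s by near: s; apply: (cvgr_gt k).
  have v0 : 0 < expR (b * s) * w s by rewrite mulr_gt0 ?expR_gt0.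
  have L0 : 0 < L s.
    rewrite /L ln_gt0//; have := sqr_ge0 (expR (b * s) * w s); lra.
  rewrite invf_div powRM ?invr_ge0 ?ltW// /f -/(L s) gtr0_norm//.
  rewrite [_ `^ (p - 1) * _]mulrC mulr_powRB1 ?ltW// powRM ?expR_ge0 ?ltW//.
  rewrite -expRM -[(L s)^-1]powR_inv1 ?ltW// -powRrM mulN1r powRN.
  have -> : expR (- (p * b) * s) = (expR (b * s * p))^-1.
    by rewrite -expRN; congr expR; ring.
  field.
  by rewrite !gt_eqF ?expR_gt0 ?powR_gt0.
apply: cvgM; first exact: cvg_powR.
apply: cvg_powR; first by rewrite invr_gt0 mulr_gt0.
apply: cvgV; first by rewrite gt_eqF// mulr_gt0.
exact: (ln_expR_sqr_cvg _ _ k).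
Unshelve. all: by end_near. Qed.

(** * Linearization at [kappa0] and the asymptotics of [phi] and its derivative *)

Theorem claimB1 (R : realType) (p a : R) (hp : 1 < p) (ha : 1 < a)
    (t0 : R) (ht0 : 0 < t0) (phi0 : R -> R)
    (hsol : is_solution p a t0 phi0)
    (hasym : asymp_equiv (0 : R)^'- phi0
       (fun t : R => kappa0 p * (- t) `^ (- (2 / (p - 1))))) :
  asymp_equiv (pinfty_nbhs R) (fun s : R => phi p phi0 s - kappa0 p)
    (fun s : R => - (kappa0 p / (p - 1)) * ((p - 1) / (4 * s)) `^ a)
  /\ (exists C : R, 0 < C /\
        \forall s \near +oo, `|((phi p phi0)^`())%classic s| <= C / s `^ a).
Proof.
pose beta : R := 2 / (p - 1).
pose c := beta * (beta + 1).
have p0 : 0 < p by lra.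
have p10 : 0 < p - 1 by lra.
have a0 : 0 < a by lra.
have b0 : 0 < beta by rewrite divr_gt0.
have c0 : 0 < c by rewrite mulr_gt0//; lra.
have cE : 2 * (p + 1) / (p - 1) ^+ 2 = c.
  by rewrite /c /beta; field; rewrite gt_eqF.
have k0 : 0 < kappa0 p by rewrite powR_gt0// cE.
have kp1 : kappa0 p `^ (p - 1) = c.
  by rewrite /kappa0 cE -powRrM divfK ?gt_eqF// powRr1 ?ltW.
have kp : kappa0 p `^ p = c * kappa0 p.
  by rewrite -(mulr_powRB1 (ltW k0) p0) kp1 mulrC.
have phik := phi_cvg _ _ _ hp hasym.
(* The limit [kappa0 p] is positive, so [phi] is eventually nonnegative and the differential
   equation is available. *)
have phi_ge0 : \forall s \near +oo, 0 <= phi p phi0 s.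
  exact: (cvgr_ge (kappa0 p)).
have [u1 [u2 [dphi du1 ode]]] := phi_ode _ _ _ _ _ hp ht0 hsol phi_ge0.
(* [P] is the autonomous part of the equation. Since [kappa0^(p-1) = c], it vanishes at [kappa0],
   with slope [p c - c = M] there. *)
pose P (x : R) := x `^ p - c * x.
pose M := (p - 1) * c.
have M0 : 0 < M by rewrite mulr_gt0.
have dP : is_derive (kappa0 p) 1 P M.
  have dpow := is_derive1_powR p k0.
  apply: is_derive_eq.
  by rewrite kp1 /M /GRing.scale /=; ring.
(* Caratheodory's slope function of [P] at [kappa0] linearizes exactly. *)
have [q [qE qc qM]] := (is_derive1_caratheodory P (kappa0 p) M).1 dP.
have Pk : P (kappa0 p) = 0 by rewrite /P kp subrr.
pose u s := phi p phi0 s - kappa0 p.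
pose m s := q (phi p phi0 s).
pose g s := expR (- (p * beta) * s) * f p a (expR (beta * s) * phi p phi0 s).
pose G := kappa0 p `^ p * (2 * beta)^-1 `^ a.
have du : \forall s \near +oo, is_derive (s : R) 1 u (u1 s).
  by apply: filterS dphi => s ds; apply: is_derive_eq; rewrite subr0.
have uode : \forall s \near +oo, u2 s + (2 * beta + 1) * u1 s = m s * u s + g s.
  by apply: filterS ode => s ->; rewrite -qE Pk /P -/c /g; ring.
have mM : m s @[s --> +oo] --> M by rewrite -qM; exact: cvg_comp _ _ phik qc.
have gG : g s * s `^ a @[s --> +oo] --> G by exact: nonlinearity_cvg.
have u0 : u s @[s --> +oo] --> 0.
  by rewrite -(subrr (kappa0 p)); apply: cvgB => //; exact: cvg_cst.
have b10 : 0 < 2 * beta + 1 by lra.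
have uasym := ode_eventually_asymp _ _ _ _ _ _ _ _ _ _ a0 b10 M0 du du1 uode mM gG u0.
(* The quotient [kappa0^p / M] reduces to [kappa0 / (p - 1)], and [(2 beta)^-1 = (p - 1) / 4] is the
   base of the power in the claim. *)
have GE : G / M = kappa0 p / (p - 1) * ((p - 1) / 4) `^ a.
  have -> : (p - 1) / 4 = (2 * beta)^-1 by rewrite /beta; field; rewrite gt_eqF.
  by rewrite /G /M kp; field; rewrite !gt_eqF.
have G0 : 0 < G / M.
  by rewrite GE mulr_gt0 ?powR_gt0 ?divr_gt0.
split.
  apply/asymp_equivP => e e0.
  (* A relative error [e] against [(G / M) s^-a] is an absolute error with coefficient
     [e * (G / M)]. *)
  have eG : 0 < e * (G / M) by rewrite mulr_gt0.
  near=> s.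
  have s0 : 0 < s by near: s; apply: nbhs_pinfty_gt; exact: num_real.
  have -> : - (kappa0 p / (p - 1)) * ((p - 1) / (4 * s)) `^ a =
      - (G / M * s `^ (- a)).
    rewrite GE powRN.
    have -> : (p - 1) / (4 * s) = (p - 1) / 4 * s^-1.
      by field; rewrite gt_eqF.
    rewrite powRM ?divr_ge0 ?invr_ge0 ?ltW// -[s^-1]powR_inv1 ?ltW// -powRrM.
    by rewrite mulN1r powRN; ring.
  rewrite opprK normrN (ger0_norm (_ : 0 <= G / M * _)).
    by rewrite mulrA; near: s; exact: uasym.
  by rewrite mulr_ge0 ?powR_ge0 ?ltW.
(* The equation is read as a first-order one for [u1], with right-hand side [m u + g]. Eventually
   [|m| <= M + 1], [|u| <= (1 + G / M) s^-a] and [|g| <= (|G| + 1) s^-a], which gives the constant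
   below. *)
have [C C0 HC] : exists2 C, 0 < C & \forall s \near +oo, `|u1 s| <= C * s `^ (- a).
  apply: (linear_ode_eventually_bounded _ u1 u2 a (2 * beta + 1)
    ((M + 1) * (1 + G / M) + (`|G| + 1))) => //.
  have mle : \forall s \near +oo, `|m s| <= M + 1.
    apply: (cvgr_le `|M|); first exact: cvg_norm.
    by rewrite gtr0_norm// ltrDl.
  have gle : \forall s \near +oo, `|g s * s `^ a| <= `|G| + 1.
    by apply: (cvgr_le `|G|); [exact: cvg_norm|rewrite ltrDl].
  near=> s.
  have s0 : 0 < s by near: s; apply: nbhs_pinfty_gt; exact: num_real.
  have h0 : 0 < s `^ (- a) by rewrite powR_gt0.
  have -> : u2 s + (2 * beta + 1) * u1 s = m s * u s + g s by near: s.
  rewrite (le_trans (ler_normD _ _))// mulrDl lerD//.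
    rewrite normrM -mulrA ler_pM//; first by near: s.
    have us : `|u s + G / M * s `^ (- a)| <= 1 * s `^ (- a).
      by near: s; exact: uasym.
    rewrite -[u s](addrK (G / M * s `^ (- a))) (le_trans (ler_normB _ _))//.
    by rewrite mulrDl lerD// ger0_norm// mulr_ge0 ?ltW.
  have -> : g s = g s * s `^ a * s `^ (- a).
    by rewrite powRN mulfK// gt_eqF// powR_gt0.
  rewrite normrM (gtr0_norm h0) ler_wpM2r ?powR_ge0//.
  by near: s.
exists C; split => //; near=> s.
have ds : is_derive s 1 (phi p phi0) (u1 s) by near: s.
rewrite derive1E -powRN; have [_ ->] := ds.
by near: s.
Unshelve. all: by end_near. Qed.
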